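(* Let $H$ and $K$ be Hilbert $\mathfrak{A}$-modules over a $C^*$-algebra $\mathfrak{A}$. Let operators $A,A_n\in\mathcal{L}(H,K)\setminus\{0\}$ and weights $M,M_n\in\mathcal{L}(K)$, $N,N_n\in\mathcal{L}(H)$ ($n\in\mathbb{N}$) be given such that $A_n\to A$, $M_n\to M$ and $N_n\to N$ in the operator-norm topology. Suppose that $A^\dag_{MN}$ exists, and that $(A_n)^\dag_{M_nN_n}$ exists for every $n\in\mathbb{N}$. Then the following conditions are equivalent: (i) $\lim_{n\to\infty}\big\|(A_n)^\dag_{M_nN_n}-A^\dag_{MN}\big\|=0$; (ii) $\sup_n\big\|(A_n)^\dag_{M_nN_n}\big\|<+\infty$; (iii) $\sup_n\|A_n^\dag\|<+\infty$; (iv) $\lim_{n\to\infty}\big\|A_n^\dag A_n-A^\dag A\big\|=0$; (v) $\lim_{n\to\infty}\big\|A_nA_n^\dag-AA^\dag\big\|=0$; (vi) $\lim_{n\to\infty}\big\|A_n^\dag-A^\dag\big\|=0$.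
   Context: $\mathcal{L}(H,K)$ is the set of adjointable operators from $H$ to $K$, $\mathcal{L}(H)=\mathcal{L}(H,H)$. A weight on $K$ is an operator $M\in\mathcal{L}(K)$ with $M=M^*$ that is invertible in $\mathcal{L}(K)$ (it need not be positive). For weights $M\in\mathcal{L}(K)$, $N\in\mathcal{L}(H)$ and $A\in\mathcal{L}(H,K)$, the weighted Moore-Penrose inverse $A^\dag_{MN}$ (if it exists) is the (necessarily unique) element $X\in\mathcal{L}(K,H)$ satisfying $AXA=A$, $XAX=X$, $(MAX)^*=MAX$, $(NXA)^*=NXA$. The Moore-Penrose inverse is $A^\dag=A^\dag_{I_KI_H}$; it exists whenever $A^\dag_{MN}$ exists for some weights $M,N$. *)

(* Defs.v *)
From HB Require Import structures.
From mathcomp Require Import all_boot all_order all_algebra.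
From mathcomp Require Import all_classical all_reals all_analysis.
From mathcomp Require Export complex.

Set Implicit Arguments.
Unset Strict Implicit.
Unset Printing Implicit Defensive.
Import Order.TTheory GRing.Theory Num.Theory.
Import numFieldNormedType.Exports.

Local Open Scope classical_set_scope.
Local Open Scope ring_scope.

(* The multiplication has no unit: C*-algebras need not be unital, so the
   ring structures of MathComp do not apply. The norm takes its (real,
   nonnegative) values in R[i], as for every normed R[i]-module. *)
HB.mixin Record isCStarAlgebra (R : realType) A
    of CompleteNormedModule R[i] A := {
  cmul : A -> A -> A;
  star : A -> A;
  cmulA : forall a b c, cmul a (cmul b c) = cmul (cmul a b) c;
  cmulDl : forall a b c, cmul (a + b) c = cmul a c + cmul b c;
  cmulDr : forall a b c, cmul a (b + c) = cmul a b + cmul a c;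
  cmulZl : forall (l : R[i]) a b, cmul (l *: a) b = l *: cmul a b;
  cmulZr : forall (l : R[i]) a b, cmul a (l *: b) = l *: cmul a b;
  starK : forall a, star (star a) = a;
  starD : forall a b, star (a + b) = star a + star b;
  starZ : forall (l : R[i]) a, star (l *: a) = Num.conj l *: star a;
  starM : forall a b, star (cmul a b) = cmul (star b) (star a);
  cnormM : forall a b, `|cmul a b| <= `|a| * `|b|;
  cnorm_star : forall a, `|cmul (star a) a| = `|a| ^+ 2
}.

#[short(type="cstarAlgType")]
HB.structure Definition CStarAlgebra (R : realType) :=
  {A of isCStarAlgebra R A & CompleteNormedModule R[i] A}.

Definition cpos (R : realType) (A : cstarAlgType R) (a : A) : Prop :=
  exists b : A, a = cmul (star b) b.

(* Right modules, with inner product linear in the second variable.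
   Completeness for the norm `|<x, x>|^(1/2) is inherited from
   CompleteNormedModule, through hnormE. *)
HB.mixin Record isHilbertModule (R : realType) (A : cstarAlgType R) H
    of CompleteNormedModule R[i] H := {
  ract : H -> A -> H;
  inner : H -> H -> A;
  ractDl : forall x y a, ract (x + y) a = ract x a + ract y a;
  ractDr : forall x a b, ract x (a + b) = ract x a + ract x b;
  ractM : forall x a b, ract x (cmul a b) = ract (ract x a) b;
  ractZl : forall (l : R[i]) x a, ract (l *: x) a = l *: ract x a;
  ractZr : forall (l : R[i]) x a, ract x (l *: a) = l *: ract x a;
  innerDr : forall x y z, inner x (y + z) = inner x y + inner x z;
  innerZr : forall (l : R[i]) x y, inner x (l *: y) = l *: inner x y;
  inner_ract : forall x y a, inner x (ract y a) = cmul (inner x y) a;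
  inner_star : forall x y, star (inner x y) = inner y x;
  inner_pos : forall x, cpos (inner x x);
  inner_eq0 : forall x, inner x x = 0 -> x = 0;
  hnormE : forall x, `|x| ^+ 2 = `|inner x x|
}.

#[short(type="hilbertModType")]
HB.structure Definition HilbertModule (R : realType) (A : cstarAlgType R) :=
  {H of isHilbertModule R A H & CompleteNormedModule R[i] H}.

Section inner_theory.
Variables (R : realType) (A : cstarAlgType R) (H : hilbertModType A).
Implicit Types x y z : H.

Lemma innerDl x y z : inner (x + y) z = inner x z + inner y z.
Proof. by rewrite -inner_star innerDr starD !inner_star. Qed.

Lemma innerZl (l : R[i]) x y : inner (l *: x) y = Num.conj l *: inner x y.
Proof. by rewrite -inner_star innerZr starZ inner_star. Qed.

Lemma inner0r x : inner x 0 = 0.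
Proof. by rewrite -(scale0r 0) innerZr scale0r. Qed.

Lemma innerBr x y z : inner x (y - z) = inner x y - inner x z.
Proof. by rewrite innerDr -(scaleN1r z) innerZr scaleN1r. Qed.

Lemma inner_inj y z : (forall x, inner x y = inner x z) -> y = z.
Proof.
move=> yz; apply/eqP; rewrite -subr_eq0; apply/eqP/inner_eq0.
by rewrite innerBr yz subrr.
Qed.

End inner_theory.

Section adjointable_operators.
Variables (R : realType) (A : cstarAlgType R) (H K : hilbertModType A).

Definition is_adjoint (f : H -> K) (g : K -> H) : Prop :=
  forall x y, inner (f x) y = inner x (g y).

Definition adjointable : {pred H -> K} :=
  fun f => `[< exists g : K -> H, is_adjoint f g >].

Fact adjointable_submod_closed : submod_closed adjointable.
Proof.
split.
- apply/asboolP; exists (fun=> 0) => x y.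
  by rewrite -(scale0r 0) innerZl rmorph0 scale0r inner0r.
- move=> l f1 f2 /asboolP[g1 fg1] /asboolP[g2 fg2]; apply/asboolP.
  exists (fun y => Num.conj l *: g1 y + g2 y) => x y.
  by rewrite innerDl innerZl fg1 fg2 innerDr innerZr.
Qed.

HB.instance Definition _ :=
  GRing.isSubmodClosed.Build _ _ adjointable adjointable_submod_closed.

Record adjop := Adjop { adjop_fun :> H -> K ; _ : adjop_fun \in adjointable }.

HB.instance Definition _ := [isSub for adjop_fun].
HB.instance Definition _ := [Choice of adjop by <:].
HB.instance Definition _ := [SubChoice_isSubLmodule of adjop by <:].

Lemma adjopP (S T : adjop) : S =1 T -> S = T.
Proof. by move=> ST; apply/val_inj/funext. Qed.

Lemma adjop_adjoint (T : adjop) : exists g : K -> H, is_adjoint T g.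
Proof. by case: T => f /= /asboolP. Qed.

(* The operator norm, with values in the extended reals as for Lnorm: no
   boundedness is required in the definition of the supremum. *)
Definition opnorm (T : adjop) : \bar R :=
  ereal_sup [set (complex.Re `|T x|)%:E | x in [set x : H | `|x| <= 1]].

End adjointable_operators.

Arguments adjointable {R A} H K _.

(* Adjointable operators from H to K *)
Notation "'L(' H , K ')'" := (adjop H K)
  (at level 0, H at level 99, K at level 99, format "'L(' H ,  K ')'")
  : type_scope.

Section adjoint.
Variables (R : realType) (A : cstarAlgType R) (H K : hilbertModType A).
Variable T : L(H, K).

Definition adj_fun : K -> H := projT1 (cid (adjop_adjoint T)).

Lemma adj_funP : is_adjoint T adj_fun.
Proof. exact: projT2 (cid (adjop_adjoint T)). Qed.

Fact adj_adjointable : adj_fun \in adjointable K H.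
Proof.
apply/asboolP; exists T => x y.
by rewrite -inner_star -adj_funP inner_star.
Qed.

Definition adj : L(K, H) := Adjop adj_adjointable.

Lemma adjP : is_adjoint T adj.
Proof. exact: adj_funP. Qed.

End adjoint.

Section composition.
Variables (R : realType) (A : cstarAlgType R) (H K G : hilbertModType A).

Fact comp_adjointable (S : L(K, G)) (T : L(H, K)) :
  (S : K -> G) \o T \in adjointable H G.
Proof.
by apply/asboolP; exists (adj T \o adj S) => x y; rewrite /= adjP adjP.
Qed.

Definition opcomp (S : L(K, G)) (T : L(H, K)) : L(H, G) :=
  Adjop (comp_adjointable S T).

Fact id_adjointable : (@id H) \in adjointable H H.
Proof. by apply/asboolP; exists id. Qed.

Definition opid : L(H, H) := Adjop id_adjointable.

End composition.

Arguments opid {R A} H.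
Notation "S ∘ T" := (opcomp S T) (at level 40, left associativity) : ring_scope.

Section weighted_moore_penrose.
Variables (R : realType) (A : cstarAlgType R).

Definition op_invertible (H : hilbertModType A) (M : L(H, H)) : Prop :=
  exists M' : L(H, H), M ∘ M' = opid H /\ M' ∘ M = opid H.

Definition weight (H : hilbertModType A) (M : L(H, H)) : Prop :=
  adj M = M /\ op_invertible M.

Variables (H K : hilbertModType A).

Definition is_wmpinv (M : L(K, K)) (N : L(H, H)) (T : L(H, K)) (X : L(K, H))
    : Prop :=
  [/\ T ∘ X ∘ T = T, X ∘ T ∘ X = X,
      adj (M ∘ T ∘ X) = M ∘ T ∘ X & adj (N ∘ X ∘ T) = N ∘ X ∘ T].

Definition wmpinv_exists (M : L(K, K)) (N : L(H, H)) (T : L(H, K)) : Prop :=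
  exists X : L(K, H), is_wmpinv M N T X.

(* The weighted inverse when it exists (it is unique, see is_wmpinv_unique),
   0 otherwise. *)
Definition wmpinv (M : L(K, K)) (N : L(H, H)) (T : L(H, K)) : L(K, H) :=
  xget 0 [set X | is_wmpinv M N T X].

Definition mpinv (T : L(H, K)) : L(K, H) := wmpinv (opid K) (opid H) T.

End weighted_moore_penrose.

Section operator_theory.
Variables (R : realType) (A : cstarAlgType R).

Lemma opcompA (H K G F : hilbertModType A)
    (S : L(G, F)) (T : L(K, G)) (U : L(H, K)) : S ∘ (T ∘ U) = S ∘ T ∘ U.
Proof. exact: adjopP. Qed.

Lemma opcomp1o (H K : hilbertModType A) (T : L(H, K)) : opid K ∘ T = T.
Proof. exact: adjopP. Qed.

Lemma opcompo1 (H K : hilbertModType A) (T : L(H, K)) : T ∘ opid H = T.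
Proof. exact: adjopP. Qed.

Lemma adj_unique (H K : hilbertModType A) (T : L(H, K)) (S : L(K, H)) :
  is_adjoint T S -> adj T = S.
Proof.
by move=> TS; apply: adjopP => y; apply: inner_inj => x; rewrite -adjP TS.
Qed.

Lemma adj_comp (H K G : hilbertModType A) (S : L(K, G)) (T : L(H, K)) :
  adj (S ∘ T) = adj T ∘ adj S.
Proof. by apply: adj_unique => x y; rewrite /= !adjP. Qed.

Lemma weight_injl (H K : hilbertModType A) (M : L(K, K)) (S T : L(H, K)) :
  weight M -> M ∘ S = M ∘ T -> S = T.
Proof.
move=> [_ [M' [_ M'M]]] /(congr1 (opcomp M')).
by rewrite !opcompA M'M !opcomp1o.
Qed.

(* Two M-selfadjoint idempotents P = M^-1 P^* M and Q with the same range
   coincide. *)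
Lemma selfadj_idem_eq (K : hilbertModType A) (M P Q : L(K, K)) :
  weight M -> adj (M ∘ P) = M ∘ P -> adj (M ∘ Q) = M ∘ Q ->
  P ∘ Q = Q -> Q ∘ P = P -> P = Q.
Proof.
move=> wM MP MQ PQ QP; have [sM _] := wM; apply: (weight_injl wM).
have QM : adj Q ∘ M = M ∘ Q by rewrite -MQ adj_comp sM.
have PM : adj P ∘ M = M ∘ P by rewrite -MP adj_comp sM.
rewrite -[in LHS]QP opcompA -QM -opcompA -PM opcompA.
by rewrite -adj_comp PQ.
Qed.

Lemma selfadj_idem_eq_ker (H : hilbertModType A) (N P Q : L(H, H)) :
  weight N -> adj (N ∘ P) = N ∘ P -> adj (N ∘ Q) = N ∘ Q ->
  P ∘ Q = P -> Q ∘ P = Q -> P = Q.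
Proof.
move=> wN NP NQ PQ QP; have [sN _] := wN; apply: (weight_injl wN).
have QN : adj Q ∘ N = N ∘ Q by rewrite -NQ adj_comp sN.
have PN : adj P ∘ N = N ∘ P by rewrite -NP adj_comp sN.
rewrite -[in LHS]PQ opcompA -PN -opcompA -QN opcompA.
by rewrite -adj_comp QP.
Qed.

Lemma is_wmpinv_unique (H K : hilbertModType A) (M : L(K, K)) (N : L(H, H))
    (T : L(H, K)) (X Y : L(K, H)) :
  weight M -> weight N -> is_wmpinv M N T X -> is_wmpinv M N T Y -> X = Y.
Proof.
move=> wM wN [TXT XTX MTX NXT] [TYT YTY MTY NYT].
have TXTY : T ∘ X = T ∘ Y.
  apply: (selfadj_idem_eq wM); rewrite ?opcompA //; first by rewrite TXT.
  by rewrite TYT.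
have XTYT : X ∘ T = Y ∘ T.
  apply: (selfadj_idem_eq_ker wN); rewrite ?opcompA //.
    by rewrite -!(opcompA X) TYT.
  by rewrite -!(opcompA Y) TXT.
by rewrite -XTX -opcompA TXTY opcompA XTYT YTY.
Qed.

Lemma wmpinvP (H K : hilbertModType A) (M : L(K, K)) (N : L(H, H))
    (T : L(H, K)) :
  wmpinv_exists M N T -> is_wmpinv M N T (wmpinv M N T).
Proof. by move=> [X TX]; exact: (xgetI 0 TX). Qed.

End operator_theory.

(* Main.v *)
(* Orthogonal projections are contractions, and a Moore-Penrose inverse factors
   through any generalized inverse as q X p, with p and q the orthogonal
   projections on the range and the corange; this gives (ii) -> (iii). A bound
   on the inverses Y_n of A_n controls Y_n A_n - Y A, and conversely
   convergence of these projections gives Y_n = Y A_n Y_n - E_n Y_n with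
   E_n -> 0, hence a bound; passing to adjoints exchanges (iv) and (v). For the
   weights, the idempotent P_n = A_n X_n is determined by
   p_n M_n P_n = p_n M_n, where p_n = A_n Y_n has the same range, and p M p has
   the left inverse M^-1 (adj P) on the range of p, so that p_n -> p forces
   P_n -> P; finally X_n = (X_n A_n) Y_n (A_n X_n).

   Positivity in the C-star algebra is never used: the triangle inequality of
   the norm gives the Cauchy-Schwarz inequality up to a factor 4, and
   |x| <= |x + y| for orthogonal x and y. *)

From HB Require Import structures.
Require Import Defs.
From mathcomp Require Import all_boot all_order all_algebra.
From mathcomp Require Import all_classical all_reals all_analysis.
From mathcomp Require Import ring lra.

Set Implicit Arguments.
Unset Strict Implicit.
Unset Printing Implicit Defensive.

Import Order.TTheory GRing.Theory Num.Theory.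
Import numFieldNormedType.Exports.

Local Open Scope classical_set_scope.
Local Open Scope ring_scope.

(** * Real-valued norms and geometric convergence *)

Section real_norm.
Variables (R : realType) (V : normedModType R[i]).
Implicit Types x y z : V.

(** Norms take values in [R[i]]; the real part loses nothing ([nrmE]) and moves inequalities to the
    totally ordered field [R]. *)
Definition nrm x : R := complex.Re `|x|.

Lemma nrmE x : `|x| = (nrm x)%:C%C.
Proof. by rewrite /nrm RRe_real// normr_real. Qed.

Lemma nrm_ge0 x : 0 <= nrm x.
Proof. by rewrite -lecR -nrmE normr_ge0. Qed.

Lemma nrmD x y : nrm (x + y) <= nrm x + nrm y.
Proof. by rewrite -lecR rmorphD /= -!nrmE ler_normD. Qed.

Lemma nrmN x : nrm (- x) = nrm x.
Proof. by rewrite /nrm normrN. Qed.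

Lemma nrmB x y : nrm (x - y) <= nrm x + nrm y.
Proof. by rewrite -(nrmN y) nrmD. Qed.

Lemma nrmC x y : nrm (x - y) = nrm (y - x).
Proof. by rewrite -nrmN opprB. Qed.

Lemma nrm0 : nrm 0 = 0.
Proof. by rewrite /nrm normr0. Qed.

Lemma nrmZ (l : R[i]) x : nrm (l *: x) = complex.Re `|l| * nrm x.
Proof.
by apply: complexI; rewrite rmorphM /= -!nrmE normrZ.
Qed.

Lemma nrmZr (r : R) x : nrm (r%:C%C *: x) = `|r| * nrm x.
Proof. by rewrite nrmZ normc_def /= expr0n /= addr0 sqrtr_sqr. Qed.

Lemma nrmZi x : nrm ('i *: x) = nrm x.
Proof. by rewrite nrmZ normCi /= mul1r. Qed.

Lemma nrm_eq0 x : nrm x = 0 -> x = 0.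
Proof. by move=> x0; apply/normr0_eq0; rewrite nrmE x0. Qed.

Lemma nrm_gt0 x : x != 0 -> 0 < nrm x.
Proof.
by move=> x0; rewrite lt0r nrm_ge0 andbT; apply: contra_neq x0 => /nrm_eq0.
Qed.

Lemma nrm_normalize x : x != 0 -> nrm ((nrm x)^-1%:C%C *: x) = 1.
Proof.
move=> /nrm_gt0 x0; rewrite nrmZr ger0_norm ?invr_ge0 ?nrm_ge0//.
by rewrite mulVf// gt_eqF.
Qed.

End real_norm.

Lemma geo_cvg (R : realType) (V : completeNormedModType R[i]) (u : nat -> V)
    (C q : R) :
  0 <= q -> q < 1 -> (forall n, nrm (u n.+1 - u n) <= C * q ^+ n) ->
  exists l, forall n, nrm (u n - l) <= C * q ^+ n / (1 - q).
Proof.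
move=> q0 q1 uC.
have q1' : 0 < 1 - q by rewrite subr_gt0.
have C0 : 0 <= C by have := uC 0%N; rewrite expr0 mulr1; apply/le_trans/nrm_ge0.
have dist n k : nrm (u n - u (n + k)%N) <= C * q ^+ n / (1 - q).
  (* The induction on [k] needs the exact partial geometric sum; the factor [1 - q ^+ k] is dropped
     afterwards. *)
  have : nrm (u n - u (n + k)%N) <= C * q ^+ n * (1 - q ^+ k) / (1 - q).
    elim: k => [|k IH].
      by rewrite addn0 subrr nrm0 expr0 subrr mulr0 mul0r.
    rewrite addnS -(subrKA (u (n + k)%N)) (le_trans (nrmD _ _))//.
    rewrite [X in _ + X]nrmC (le_trans (lerD IH (uC _)))//.
    rewrite exprD exprS le_eqVlt; apply/orP; left; apply/eqP; field.
    by rewrite gt_eqF.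
  move/le_trans; apply; rewrite ler_pM2r ?invr_gt0//.
  by rewrite ler_piMr ?mulr_ge0 ?exprn_ge0// gerBl exprn_ge0.
have cvgC : (fun n => C * q ^+ n / (1 - q)) @ \oo --> (0 : R).
  rewrite -(mul0r (1 - q)^-1) -(mulr0 C).
  by apply: cvgMr_tmp; apply: cvgMl_tmp; apply: cvg_expr; rewrite ger0_norm.
have /cvg_ex[l ul] : cvgn u.
  apply/cauchy_cvgP/cauchy_exP => e e0.
  have eE : e = (complex.Re e)%:C%C by rewrite RRe_real// gtr0_real.
  have {}e0 : 0 < complex.Re e by rewrite -ltcR -eE.
  have [n _ ne] := cvgr0_norm_lt _ cvgC _ e0.
  exists (u n), n => // m /= nm; rewrite -ball_normE /= nrmE eE ltcR.
  rewrite -(subnKC nm); apply: le_lt_trans (dist _ _) _.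
  exact: le_lt_trans (ler_norm _) (ne n (leqnn n)).
exists l => n; apply/ler_addgt0Pr => e e0.
have /cvgrPdist_lt/(_ e%:C%C) := ul; rewrite ltcR => /(_ e0)[m _ me].
rewrite -(subrKA (u (n + m)%N)) (le_trans (nrmD _ _))// lerD ?dist//.
have := me (n + m)%N (leq_addl _ _); rewrite /= nrmE ltcR nrmC.
exact: ltW.
Qed.

(** * Norm inequalities for the inner product *)

Section hilbert_module.
Variables (R : realType) (A : cstarAlgType R) (H : hilbertModType A).
Implicit Types x y z : H.

Lemma nrm_inner x : nrm (inner x x) = nrm x ^+ 2.
Proof. by apply: complexI; rewrite rmorphXn /= -!nrmE hnormE. Qed.

Lemma inner0l x : inner 0 x = 0.
Proof. by rewrite -(scale0r 0) innerZl rmorph0 scale0r. Qed.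

Lemma innerNl x y : inner (- x) y = - inner x y.
Proof. by rewrite -scaleN1r innerZl rmorphN1 scaleN1r. Qed.

Lemma innerNr x y : inner x (- y) = - inner x y.
Proof. by rewrite -scaleN1r innerZr scaleN1r. Qed.

Lemma inner_sqrD x y : inner (x + y) (x + y)
  = inner x x + inner y y + (inner x y + inner y x).
Proof. by rewrite innerDl !innerDr [inner y x + _]addrC addrACA. Qed.

Lemma inner_sqrB x y : inner (x - y) (x - y)
  = inner x x + inner y y - (inner x y + inner y x).
Proof. by rewrite inner_sqrD !innerNl !innerNr opprK -opprD. Qed.

(** The symmetric part of the inner product is half the difference of the squares of [x + y] and
    [x - y]. *)
Lemma nrm_innerD x y :
  nrm (inner x y + inner y x) <= (nrm x + nrm y) ^+ 2.
Proof.
have E : (2 : R)%:C%C *: (inner x y + inner y x)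
    = inner (x + y) (x + y) - inner (x - y) (x - y).
  rewrite rmorph_nat scaler_nat mulr2n inner_sqrD inner_sqrB opprB.
  by rewrite [RHS]addrC subrKA.
have := nrmB (inner (x + y) (x + y)) (inner (x - y) (x - y)).
rewrite -E nrmZr ger0_norm// !nrm_inner => /le_trans h.
rewrite -(ler_pM2l (ltr0Sn _ 1)) h// mulr2n mulrDl mul1r.
rewrite lerD// lerXn2r// ?nnegrE ?addr_ge0 ?nrm_ge0//.
- exact: nrmD.
- exact: nrmB.
Qed.

(* Polarization and the triangle inequality of the given norm. The sharp
   constant 1 would need the order structure of the algebra. *)
Lemma nrm_inner_le x y : nrm (inner x y) <= 4 * nrm x * nrm y.
Proof.
have weak (u v : H) : nrm (inner u v) <= (nrm u + nrm v) ^+ 2.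
  (* Taken with its factor [- 'i], the symmetric part at ['i *: v] is [inner u v - inner v u]. *)
  have E : (2 : R)%:C%C *: inner u v
      = (inner u v + inner v u) - 'i *: (inner u ('i *: v) + inner ('i *: v) u).
    rewrite innerZr innerZl conjCi scalerDr !scalerA mulrN -expr2 sqrCi opprK.
    rewrite scale1r scaleN1r opprD opprK addrACA subrr addr0.
    by rewrite rmorph_nat scaler_nat mulr2n.
  rewrite -(ler_pM2l (ltr0Sn _ 1)) -[leLHS]ger0_norm ?mulr_ge0 ?nrm_ge0//.
  rewrite normrM [`|nrm _|]ger0_norm ?nrm_ge0// -nrmZr E.
  rewrite (le_trans (nrmB _ _))// mulr2n mulrDl mul1r lerD ?nrm_innerD//.
  by rewrite nrmZi (le_trans (nrm_innerD _ _))// nrmZi.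
have [->|x0] := eqVneq x 0; first by rewrite inner0l !nrm0 mulr0 mul0r.
have [->|y0] := eqVneq y 0; first by rewrite inner0r !nrm0 mulr0.
(* For unit vectors the weak bound is [(1 + 1) ^+ 2 = 4]. *)
have := weak ((nrm x)^-1%:C%C *: x) ((nrm y)^-1%:C%C *: y).
rewrite !nrm_normalize// innerZl innerZr !nrmZ.
rewrite norm_conjC !normc_def /= !expr0n /= !addr0 !sqrtr_sqr.
rewrite !ger0_norm ?invr_ge0 ?nrm_ge0//.
rewrite mulrA -invfM mulrC ler_pdivrMr ?mulr_gt0 ?nrm_gt0//.
rewrite -mulrA => /le_trans; apply.
by rewrite ler_wpM2r ?mulr_ge0 ?nrm_ge0//; lra.
Qed.

(* Reflecting one of two orthogonal vectors does not change the norm of their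
   sum, and [x] is the mean of [x + y] and [x - y]. *)
Lemma nrm_le_orthoD x y :
  inner x y + inner y x = 0 -> nrm x <= nrm (x + y).
Proof.
move=> xy.
have E : nrm (x - y) = nrm (x + y).
  apply: (@pexpIrn _ 2); rewrite ?nnegrE ?nrm_ge0// -!nrm_inner.
  by rewrite inner_sqrB inner_sqrD xy subr0 addr0.
rewrite -(ler_pM2l (ltr0Sn R 1)) -[leLHS]ger0_norm ?mulr_ge0 ?nrm_ge0//.
rewrite normrM [`|nrm _|]ger0_norm ?nrm_ge0// -nrmZr.
have -> : (2 : R)%:C%C *: x = (x + y) + (x - y).
  by rewrite rmorph_nat scaler_nat mulr2n addrACA subrr addr0.
by rewrite (le_trans (nrmD _ _))// E mulr2n mulrDl mul1r.
Qed.

End hilbert_module.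

(** * Automatic linearity and boundedness of adjointable operators *)

Section bounded_operators.
Variables (R : realType) (A : cstarAlgType R).

(** Linearity is not a field of [adjop]: the adjoint forces it, since inner products separate
    points. *)
Lemma adjopD (H K : hilbertModType A) (T : L(H, K)) (x y : H) :
  T (x + y) = T x + T y.
Proof.
apply: inner_inj => z.
by rewrite innerDr -!(inner_star _ z) !adjP innerDl starD.
Qed.

Lemma adjopZ (H K : hilbertModType A) (T : L(H, K)) (l : R[i]) (x : H) :
  T (l *: x) = l *: T x.
Proof.
apply: inner_inj => z.
by rewrite innerZr -!(inner_star _ z) !adjP innerZl starZ conjCK.
Qed.

Lemma adjop_linear (H K : hilbertModType A) (T : L(H, K)) : linear T.
Proof.
move=> l x y; apply: etrans (adjopD _ _ _) _.
by congr (_ + _); exact: adjopZ.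
Qed.

HB.instance Definition _ (H K : hilbertModType A) (T : L(H, K)) :=
  GRing.isLinear.Build R[i] H K _ T (adjop_linear T).

(** Replaces [opnorm T <= c] (equivalent for [0 <= c] by [opnormP]), so that estimates stay in
    [R]. *)
Definition opb (H K : hilbertModType A) (T : L(H, K)) (c : R) : Prop :=
  forall x, nrm (T x) <= c * nrm x.

Lemma adjK (H K : hilbertModType A) (T : L(H, K)) : adj (adj T) = T.
Proof. by apply: adj_unique => x y; rewrite -inner_star -adjP inner_star. Qed.

(* A gliding hump: otherwise pick unit vectors [y n] with [T (y n)] huge, and
   let [z n] be the direction of [T (y n)]. The signs in
   [x = \sum_n +- 10^-n z n] can be chosen so that [inner (T (y n)) x], hence
   [adj T x], is unbounded. *)
Lemma adjop_bounded (H K : hilbertModType A) (T : L(H, K)) :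
  exists2 c, 0 <= c & opb T c.
Proof.
apply: contrapT => nb.
(* The growth [20 ^+ n] beats the weights [10^-1 ^+ n] below: their product is [2 ^+ n]. *)
have [y yP] : {y : nat -> H &
    forall n, nrm (y n) <= 1 /\ 20 ^+ n < nrm (T (y n))}.
  apply: (@choice _ _ (fun n y => nrm y <= 1 /\ 20 ^+ n < nrm (T y))) => n.
  apply: contrapT => ny; apply: nb; exists (20 ^+ n); first exact: exprn_ge0.
  move=> x; have [->|x0] := eqVneq x 0; first by rewrite linear0 !nrm0 mulr0.
  rewrite leNgt; apply/negP => xT; apply: ny.
  exists ((nrm x)^-1%:C%C *: x); rewrite nrm_normalize//; split => //.
  rewrite linearZ nrmZr ger0_norm ?invr_ge0 ?nrm_ge0// mulrC.
  by rewrite ltr_pdivlMr ?nrm_gt0.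
pose z n := (nrm (T (y n)))^-1%:C%C *: T (y n).
have Ty0 n : T (y n) != 0.
  apply/eqP => E; have [_] := yP n; rewrite E nrm0.
  by rewrite ltNge exprn_ge0.
have z1 n : nrm (z n) = 1 by rewrite nrm_normalize.
pose r n : R := 10^-1 ^+ n.
have r0 n : 0 <= r n by rewrite exprn_ge0// invr_ge0.
(* With [a] and [b] the pairings of [u] and of the new hump, [b + b = (a + b) - (a - b)], so one of
   the two signs gives norm at least [nrm b]. *)
have step n (u : K) : exists v, nrm (v - u) <= r n /\
    r n * nrm (T (y n)) <= nrm (inner (T (y n)) v).
  set a := inner (T (y n)) u; set b := inner (T (y n)) ((r n)%:C%C *: z n).
  have nb' : nrm b = r n * nrm (T (y n)).
    rewrite /b innerZr nrmZr ger0_norm// /z innerZr nrmZr.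
    rewrite ger0_norm ?invr_ge0 ?nrm_ge0// nrm_inner expr2 mulKf//.
    by rewrite gt_eqF ?nrm_gt0.
  have zr : nrm ((r n)%:C%C *: z n) = r n.
    by rewrite nrmZr z1 mulr1 ger0_norm.
  have [ab|ab] := leP (nrm b) (nrm (a + b)).
    exists (u + (r n)%:C%C *: z n); rewrite innerDr -/a -/b -nb'.
    by rewrite addrC addKr zr.
  exists (u - (r n)%:C%C *: z n); rewrite innerBr -/a -/b -nb'.
  rewrite addrC addKr nrmN zr; split => //.
  have : nrm (b + b) <= nrm (a + b) + nrm (a - b).
    apply: le_trans (nrmB _ _); rewrite opprB [X in _ <= nrm X]addrC.
    by rewrite subrKA.
  rewrite -mulr2n -scaler_nat -(rmorph_nat (@real_complex_def R _ )) nrmZr.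
  by rewrite ger0_norm//; lra.
have [f fP] : {f : nat -> K -> K & forall n u, nrm (f n u - u) <= r n /\
    r n * nrm (T (y n)) <= nrm (inner (T (y n)) (f n u))}.
  apply: (@choice _ _ (fun n g => forall u, nrm (g u - u) <= r n /\
    r n * nrm (T (y n)) <= nrm (inner (T (y n)) (g u)))) => n.
  have [g gP] := choice (step n).
  by exists g.
pose x := fix x n := if n is m.+1 then f m (x m) else 0.
have [||n|l xl] := @geo_cvg R K x 1 10^-1.
- by rewrite invr_ge0.
- by rewrite invf_lt1// ltr1n.
- by rewrite mul1r; case: (fP n (x n)).
(* The later humps change the pairing with [T (y n)] by at most [4 * 10^-1 * (10 / 9) = 4 / 9] of
   [r n * nrm (T (y n))], which leaves [5 / 9]. *)
have main n : r n * nrm (T (y n)) * (5 / 9) <= 4 * nrm (adj T l).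
  have [yn1 _] := yP n; have [_ fn] := fP n (x n).
  have : nrm (inner (T (y n)) (x n.+1 - l))
      <= 4 * nrm (T (y n)) * (10^-1 * r n * (10 / 9)).
    apply: le_trans (nrm_inner_le _ _) _.
    rewrite ler_wpM2l ?mulr_ge0 ?nrm_ge0//.
    apply: le_trans (xl _) _; rewrite mul1r exprS le_eqVlt; apply/orP; left.
    by apply/eqP; rewrite /r; move: (_ ^+ n) => t; field.
  have : nrm (inner (T (y n)) l) <= 4 * nrm (adj T l).
    rewrite adjP (le_trans (nrm_inner_le _ _))// ler_wpM2r ?nrm_ge0//.
    by rewrite ler_piMr.
  have : nrm (inner (T (y n)) (x n.+1))
      <= nrm (inner (T (y n)) (x n.+1 - l)) + nrm (inner (T (y n)) l).
    by rewrite innerBr; apply: le_trans (nrmD _ _); rewrite subrK.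
  move: fn; rewrite -[f n (x n)]/(x n.+1).
  lra.
have [n nl] : exists n : nat, 4 * nrm (adj T l) < n%:R * (5 / 9).
  exists (Num.truncn (4 * nrm (adj T l) * (9 / 5))).+1.
  have := truncnS_gt (4 * nrm (adj T l) * (9 / 5)); lra.
have := main n; apply/negP; rewrite -ltNge (lt_le_trans nl)//.
rewrite ler_wpM2r//.
have [_ /ltW yn] := yP n.
apply: (@le_trans _ _ (r n * 20 ^+ n)); last by rewrite ler_wpM2l.
rewrite /r -exprMn (_ : 10^-1 * 20 = 2%:R); last by field.
by rewrite -natrX ler_nat ltnW// ltn_expl.
Qed.

End bounded_operators.

(** * Algebra of operators and adjoints *)

Section operator_algebra.
Variables (R : realType) (A : cstarAlgType R).
Implicit Types H K G : hilbertModType A.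

Lemma adjopDE H K (S T : L(H, K)) x : (S + T) x = S x + T x.
Proof. by []. Qed.

Lemma adjopNE H K (T : L(H, K)) x : (- T) x = - T x.
Proof. by []. Qed.

Lemma opcompDl H K G (S T : L(K, G)) (U : L(H, K)) :
  (S + T) ∘ U = S ∘ U + T ∘ U.
Proof. exact: adjopP. Qed.

Lemma opcompNl H K G (S : L(K, G)) (U : L(H, K)) : (- S) ∘ U = - (S ∘ U).
Proof. exact: adjopP. Qed.

Lemma opcompBl H K G (S T : L(K, G)) (U : L(H, K)) :
  (S - T) ∘ U = S ∘ U - T ∘ U.
Proof. exact: adjopP. Qed.

Lemma opcompDr H K G (U : L(K, G)) (S T : L(H, K)) :
  U ∘ (S + T) = U ∘ S + U ∘ T.
Proof. by apply: adjopP => x; exact: adjopD. Qed.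

Lemma opcompNr H K G (U : L(K, G)) (S : L(H, K)) : U ∘ (- S) = - (U ∘ S).
Proof. by apply: adjopP => x; exact: (linearN U (S x)). Qed.

Lemma opcompBr H K G (U : L(K, G)) (S T : L(H, K)) :
  U ∘ (S - T) = U ∘ S - U ∘ T.
Proof. by rewrite opcompDr opcompNr. Qed.

Lemma adjD H K (S T : L(H, K)) : adj (S + T) = adj S + adj T.
Proof.
by apply: adj_unique => x y; rewrite !adjopDE innerDl innerDr !adjP.
Qed.

Lemma adjN H K (T : L(H, K)) : adj (- T) = - adj T.
Proof.
by apply: adj_unique => x y; rewrite !adjopNE innerNl innerNr adjP.
Qed.

Lemma adjB H K (S T : L(H, K)) : adj (S - T) = adj S - adj T.
Proof. by rewrite adjD adjN. Qed.

Lemma adj_opid H : adj (opid H) = opid H.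
Proof. exact: adj_unique. Qed.

Lemma opid_weight H : weight (opid H).
Proof. by split; [exact: adj_opid|exists (opid H); rewrite opcompo1]. Qed.

End operator_algebra.

(** * Surjectivity of [1 + Z] for skew-adjoint [Z] *)

Section skew_adjoint.
Variables (R : realType) (A : cstarAlgType R) (H : hilbertModType A).
Variable Z : L(H, H).
Hypothesis skewZ : adj Z = - Z.

(** The cross terms of [x] and [t Z x] cancel, because [adj Z = - Z] and [t] is real. *)
Lemma skew_nrm_le (t : R) x : nrm x <= nrm (x + t%:C%C *: Z x).
Proof.
apply: nrm_le_orthoD; rewrite innerZl innerZr conj_Creal ?complex_real//.
by rewrite -scalerDr adjP skewZ adjopNE innerNr subrr scaler0.
Qed.

(* Continuation in [t]: by [skew_nrm_le] the inverse of [1 + t Z] is a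
   contraction, whatever [t], so that all steps can have the same length. *)
Lemma skew_surj_step (t d c : R) : opb Z c -> 0 <= d -> d * c <= 2^-1 ->
  (forall y, exists x, x + t%:C%C *: Z x = y) ->
  forall y, exists x, x + (t + d)%:C%C *: Z x = y.
Proof.
move=> Zc d0 dc /choice[S SP] y.
(* Fixed-point iteration for [x + t Z x = y - d Z x], with [S] picking preimages under [1 + t Z];
   differences at least halve at each step since [d * c <= 2^-1]. *)
pose u := fix u n := if n is m.+1 then S (y - d%:C%C *: Z (u m)) else 0.
have uS n : u n.+1 + t%:C%C *: Z (u n.+1) = y - d%:C%C *: Z (u n) by exact: SP.
have dZ x : nrm (d%:C%C *: Z x) <= 2^-1 * nrm x.
  rewrite nrmZr ger0_norm// (le_trans (ler_wpM2l d0 (Zc x)))// mulrA.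
  by rewrite ler_wpM2r ?nrm_ge0.
have [||n|l ul] := @geo_cvg R H u (nrm (u 1 - u 0)) 2^-1.
- by rewrite invr_ge0.
- by rewrite invf_lt1// ltr1n.
- elim: n => [|n IH]; first by rewrite expr0 mulr1.
  rewrite (le_trans (skew_nrm_le t _))// linearB scalerBr addrACA -opprD.
  rewrite [u n.+2 + _]uS [u n.+1 + _]uS opprB addrC subrKA.
  rewrite -scalerBr -linearB (le_trans (dZ _))// nrmC exprS mulrCA.
  by rewrite ler_wpM2l ?invr_ge0.
exists l; apply/eqP; rewrite -subr_eq0; apply/eqP/nrm_eq0/eqP.
rewrite eq_le nrm_ge0 andbT.
have res n : nrm (l + (t + d)%:C%C *: Z l - y)
    <= (1 + `|t| * `|c|) * nrm (u n.+1 - l) + nrm (u n - l).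
  have -> : l + (t + d)%:C%C *: Z l - y = - ((u n.+1 - l)
      + t%:C%C *: Z (u n.+1 - l) + d%:C%C *: Z (u n - l)).
    rewrite !linearB /= [u n.+1 - l + _]addrACA uS -opprD.
    rewrite [_ - (l + _)]addrAC subrKA !opprD !opprK.
    by rewrite rmorphD scalerDl [l + (_ + _)]addrA [- y + _]addrC [RHS]addrAC.
  rewrite nrmN (le_trans (nrmD _ _))// lerD//.
    rewrite (le_trans (nrmD _ _))// mulrDl mul1r lerD// nrmZr -mulrA.
    rewrite ler_wpM2l// (le_trans (Zc _))// ler_wpM2r ?nrm_ge0//.
    exact: ler_norm.
  by rewrite (le_trans (dZ _))// ler_piMl ?nrm_ge0// invf_le1// ler1n.
(* The residual at [l] is at most [D / 2 ^+ n], so [n] times it stays below [D] for all [n] and it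
   vanishes. With [k = 1 + |t| |c|], the two errors contribute [k + 2 <= 4 * k]. *)
set D := (1 + `|t| * `|c|) * nrm (u 1%N - u 0%N) * 4.
have small n : nrm (l + (t + d)%:C%C *: Z l - y) * n%:R <= D.
  have rD : nrm (l + (t + d)%:C%C *: Z l - y) <= D * 2^-1 ^+ n.
    have k1 : 1 <= 1 + `|t| * `|c| by rewrite lerDl mulr_ge0.
    apply: le_trans (res n) _.
    apply: le_trans (lerD (ler_wpM2l (le_trans ler01 k1) (ul n.+1)) (ul n)) _.
    have s0 : 0 <= nrm (u 1%N - u 0%N) * 2^-1 ^+ n.
      by rewrite mulr_ge0 ?nrm_ge0// exprn_ge0// invr_ge0.
    move: k1 s0; rewrite /D exprS.
    move: (1 + _) (nrm _) (_ ^+ n) => k v s k1 s0.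
    have -> : k * (v * (2^-1 * s) / (1 - 2^-1)) + v * s / (1 - 2^-1)
        = (k + 2) * (v * s) by field.
    have -> : k * v * 4 * s = (4 * k) * (v * s) by ring.
    by rewrite ler_wpM2r//; lra.
  have D0 : 0 <= D by rewrite !mulr_ge0 ?nrm_ge0// addr_ge0// mulr_ge0.
  rewrite (le_trans (ler_wpM2r (ler0n _ n) rD))// -mulrA ler_piMr//.
  rewrite exprVn mulrC ler_pdivrMr ?exprn_gt0// mul1r.
  by rewrite -natrX ler_nat ltnW// ltn_expl.
rewrite leNgt; apply/negP => r0.
have := small (Num.truncn (D / nrm (l + (t + d)%:C%C *: Z l - y))).+1.
rewrite leNgt => /negP; apply.
by rewrite mulrC -ltr_pdivrMr// truncnS_gt.
Qed.

Lemma skew_surj y : exists x, x + Z x = y.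
Proof.
have [c c0 Zc] := adjop_bounded Z.
(* The step length [1 / m] satisfies [c / m <= 1 / 2], and [m] steps lead from [0] to [1]. *)
pose m := (Num.truncn (2 * c)).+1.
have mc : m%:R^-1 * c <= 2^-1.
  rewrite mulrC ler_pdivrMr ?ltr0Sn// -ler_pdivrMl// invrK.
  by rewrite ltW// truncnS_gt.
suff : forall k y, exists x, x + (k%:R / m%:R)%:C%C *: Z x = y.
  move=> /(_ m y)[x]; rewrite divff ?pnatr_eq0// rmorph1 scale1r => <-.
  by exists x.
elim=> [{}y|k IH]; first by exists y; rewrite mul0r rmorph0 scale0r addr0.
rewrite -natr1 mulrDl mul1r.
by apply: skew_surj_step Zc _ mc IH; rewrite invr_ge0.
Qed.

End skew_adjoint.

(** * Orthogonal projections onto the ranges of idempotents *)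

Section skew_invertible.
Variables (R : realType) (A : cstarAlgType R) (H : hilbertModType A).
Implicit Types Z P S T : L(H, H).

Lemma op_invertible_comp S T :
  op_invertible S -> op_invertible T -> op_invertible (S ∘ T).
Proof.
move=> [S' [SS' S'S]] [T' [TT' T'T]]; exists (T' ∘ S'); split.
  by rewrite opcompA -(opcompA S) TT' opcompo1.
by rewrite opcompA -(opcompA T') S'S opcompo1.
Qed.

(** The adjoint [1 - Z] of [1 + Z] is onto too, and right inverses of the two are adjoint to each
    other, so the inverse is adjointable. Injectivity is [skew_nrm_le] at [t = 1]. *)
Lemma skew_invertible Z : adj Z = - Z -> op_invertible (opid H + Z).
Proof.
move=> skZ.
have skNZ : adj (- Z) = - - Z by rewrite adjN skZ.
have [g gP] := choice (skew_surj skZ).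
have [g' g'P] := choice (skew_surj skNZ).
have gadj : is_adjoint g g'.
  move=> x y; rewrite -{1}(g'P y) -{2}(gP x) innerDr innerDl adjP skZ.
  by [].
have gA : g \in adjointable H H by apply/asboolP; exists g'.
exists (Adjop gA); split; apply: adjopP => x; first exact: gP.
apply/eqP; rewrite -subr_eq0; apply/eqP/nrm_eq0/eqP.
rewrite eq_le nrm_ge0 andbT (le_trans (skew_nrm_le skZ 1 _))//.
by rewrite rmorph1 scale1r linearB addrACA -opprD /= gP subrr nrm0.
Qed.

Lemma inverse_unique S T U : T ∘ S = opid H -> S ∘ U = opid H -> T = U.
Proof. by move=> TS SU; rewrite -(opcompo1 T) -SU opcompA TS opcomp1o. Qed.

(* [p = P Q W], where [Q] is the adjoint of [P] and [W] is the inverse of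
   [1 - (P - Q)^2 = (1 + (P - Q)) (1 - (P - Q))]. *)
Lemma range_projection P : P ∘ P = P ->
  exists p : L(H, H), [/\ adj p = p, p ∘ P = P & P ∘ p = p].
Proof.
move=> PP.
pose Q := adj P; pose Z := P - Q; pose D := opid H - Z ∘ Z.
have QQ : Q ∘ Q = Q by rewrite -adj_comp PP.
have skZ : adj Z = - Z by rewrite adjB adjK opprB.
have ZZ : Z ∘ Z = P + Q - (P ∘ Q + Q ∘ P).
  by rewrite opcompBl !opcompBr PP QQ opprB addrACA -opprD.
have [W [DW WD]] : op_invertible D.
  have -> : D = (opid H + Z) ∘ (opid H + - Z).
    by rewrite opcompDl !opcompDr !opcomp1o opcompo1 opcompNr addrA subrK.
  apply: op_invertible_comp; apply: skew_invertible => //.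
  by rewrite adjN skZ.
have sD : adj D = D.
  by rewrite adjB adj_opid adj_comp skZ opcompNl opcompNr opprK.
have sW : adj W = W.
  apply: (@inverse_unique D); last exact: DW.
  by rewrite -{1}sD -adj_comp DW adj_opid.
(* [D] commutes with [P], both products being [P ∘ Q ∘ P], then with [Q] by taking adjoints; so does
   its inverse [W]. *)
have PD : P ∘ D = P ∘ Q ∘ P.
  rewrite opcompBr opcompo1 ZZ opcompBr !opcompDr !opcompA PP addrKA.
  by rewrite opprB addrC subrK.
have DP : D ∘ P = P ∘ Q ∘ P.
  rewrite opcompBl opcomp1o ZZ opcompBl !opcompDl -!(opcompA _ P P) PP.
  rewrite [P ∘ Q ∘ P + _]addrC addrKA.
  by rewrite opprB addrC subrK.
have QD : Q ∘ D = D ∘ Q by rewrite -{1}sD -adj_comp DP -PD adj_comp sD.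
have comm S : S ∘ D = D ∘ S -> S ∘ W = W ∘ S.
  move=> SD; rewrite -[LHS]opcomp1o -WD -opcompA [D ∘ _]opcompA -SD.
  by rewrite -[S ∘ D ∘ W]opcompA DW opcompo1.
have PW : P ∘ W = W ∘ P by apply: comm; rewrite PD.
have QW : Q ∘ W = W ∘ Q by exact: comm.
exists (P ∘ Q ∘ W); split.
- by rewrite !adj_comp sW adjK -/Q opcompA -PW -opcompA -QW opcompA.
- by rewrite -opcompA -PW opcompA -PD -opcompA DW opcompo1.
- by rewrite !opcompA PP.
Qed.

End skew_invertible.

(** * Existence and bounds of Moore-Penrose inverses *)

Section moore_penrose.
Variables (R : realType) (A : cstarAlgType R).
Implicit Types H K : hilbertModType A.

Lemma star0 : star (0 : A) = 0.
Proof. by rewrite -[in LHS](scale0r 0) starZ rmorph0 scale0r. Qed.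

Lemma projection_opb H (p : L(H, H)) : adj p = p -> p ∘ p = p -> opb p 1.
Proof.
move=> sp pp x; rewrite mul1r.
have ppx : p (p x) = p x by rewrite -[LHS]/((p ∘ p) x) pp.
have E : inner (p x) (x - p x) = 0.
  by rewrite adjP sp linearB /= ppx subrr inner0r.
have -> : nrm x = nrm (p x + (x - p x)) by rewrite addrC subrK.
apply: nrm_le_orthoD.
by rewrite E add0r -inner_star E star0.
Qed.

Lemma opb_comp H K (G : hilbertModType A) (S : L(K, G)) (T : L(H, K)) a b :
  0 <= a -> opb S a -> opb T b -> opb (S ∘ T) (a * b).
Proof.
move=> a0 Sa Tb x; rewrite -mulrA (le_trans (Sa _))//.
by rewrite ler_wpM2l.
Qed.

(** The case of identity weights, freed of the compositions with [opid]. *)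
Definition is_mpinv H K (T : L(H, K)) (X : L(K, H)) : Prop :=
  [/\ T ∘ X ∘ T = T, X ∘ T ∘ X = X, adj (T ∘ X) = T ∘ X & adj (X ∘ T) = X ∘ T].

(** [T ∘ X] is an idempotent with the range of [T], and [X ∘ T] one with its kernel. Projecting
    orthogonally by [p] on the range of the first and by [q] on that of the adjoint of the second,
    [Y = q ∘ X ∘ p] satisfies [T ∘ Y = p] and [Y ∘ T = q]. *)
Lemma mpinv_exists H K (T : L(H, K)) (X : L(K, H)) : T ∘ X ∘ T = T ->
  is_mpinv T (mpinv T) /\ forall c, 0 <= c -> opb X c -> opb (mpinv T) c.
Proof.
move=> TXT.
have [|p [sp pP Pp]] := @range_projection R A K (T ∘ X).
  by rewrite opcompA TXT.
have [|q [sq qQ Qq]] := @range_projection R A H (adj (X ∘ T)).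
  by rewrite -adj_comp opcompA -(opcompA X T X) -opcompA TXT.
have {}qQ : X ∘ T ∘ q = X ∘ T by rewrite -[LHS]adjK adj_comp sq qQ adjK.
have {}Qq : q ∘ (X ∘ T) = q by rewrite -[LHS]adjK adj_comp sq Qq.
have pp : p ∘ p = p by rewrite -{2}Pp opcompA pP.
have qq : q ∘ q = q by rewrite -{1}Qq -opcompA qQ.
have Tq : T ∘ q = T by rewrite -{1}TXT -!opcompA [X ∘ _]opcompA qQ opcompA.
have pT : p ∘ T = T by rewrite -{1}TXT opcompA pP.
pose Y := q ∘ X ∘ p.
have TY : T ∘ Y = p by rewrite !opcompA Tq.
have YT : Y ∘ T = q by rewrite -!opcompA pT Qq.
have mpY : is_mpinv T Y.
  by split; rewrite ?TY ?YT// !opcompA qq.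
have wY : is_wmpinv (opid K) (opid H) T Y.
  by case: mpY => *; split; rewrite ?opcomp1o.
have -> : mpinv T = Y.
  apply: (is_wmpinv_unique _ _ _ wY); try exact: opid_weight.
  by apply: wmpinvP; exists Y.
split=> // c c0 Xc; rewrite -[c]mulr1; apply: opb_comp => //; last first.
  exact: projection_opb.
by rewrite -[c]mul1r; apply: opb_comp => //; exact: projection_opb.
Qed.

End moore_penrose.

(** * Operator bounds, null sequences and limits *)

Section operator_norm.
Variables (R : realType) (A : cstarAlgType R).
Implicit Types H K G : hilbertModType A.

Lemma opnormP H K (T : L(H, K)) (c : R) :
  0 <= c -> (opnorm T <= c%:E)%E <-> opb T c.
Proof.
move=> c0; split=> [Tc x|Tc].
  have [->|x0] := eqVneq x 0; first by rewrite linear0 !nrm0 mulr0.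
  have : ((nrm (T ((nrm x)^-1%:C%C *: x)))%:E <= c%:E)%E.
    apply: le_trans Tc; apply: ereal_sup_ubound.
    exists ((nrm x)^-1%:C%C *: x) => //=.
    by rewrite nrmE nrm_normalize.
  rewrite lee_fin linearZ nrmZr ger0_norm ?invr_ge0 ?nrm_ge0// mulrC.
  by rewrite ler_pdivrMr ?nrm_gt0.
apply: ge_ereal_sup => _ [x /= x1 <-]; rewrite lee_fin -/(nrm _).
rewrite (le_trans (Tc x))// ler_piMr//.
by move: x1; rewrite nrmE -[1]/(1%:C%C) lecR.
Qed.

Lemma opnorm_ge0 H K (T : L(H, K)) : (0 <= opnorm T)%E.
Proof.
apply: ereal_sup_ubound; exists 0; first by rewrite /= normr0.
by rewrite linear0 normr0.
Qed.

Lemma opbW H K (T : L(H, K)) a b : a <= b -> opb T a -> opb T b.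
Proof. by move=> ab Ta x; rewrite (le_trans (Ta x))// ler_wpM2r ?nrm_ge0. Qed.

Lemma opbD H K (S T : L(H, K)) a b : opb S a -> opb T b -> opb (S + T) (a + b).
Proof.
move=> Sa Tb x; rewrite (le_trans (nrmD _ _))// mulrDl.
exact: lerD (Sa x) (Tb x).
Qed.

Lemma opbN H K (T : L(H, K)) a : opb T a -> opb (- T) a.
Proof. by move=> Ta x; rewrite [nrm _]nrmN; exact: Ta. Qed.

(** The square of [nrm (adj T y)] is the norm of [inner (T (adj T y)) y]; the factor 4 is that of
    [nrm_inner_le]. *)
Lemma opb_adj H K (T : L(H, K)) c : 0 <= c -> opb T c -> opb (adj T) (4 * c).
Proof.
move=> c0 Tc y; have [->|Ty0] := eqVneq (adj T y) 0.
  by rewrite nrm0 !mulr_ge0 ?nrm_ge0.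
rewrite -(ler_pM2r (nrm_gt0 Ty0)) -expr2 -nrm_inner -adjP.
rewrite (le_trans (nrm_inner_le _ _))// [leRHS]mulrAC ler_wpM2r ?nrm_ge0//.
by rewrite -mulrA ler_wpM2l//; exact: Tc.
Qed.

Definition op_to0 H K (T : nat -> L(H, K)) : Prop :=
  forall e, 0 < e -> \forall n \near \oo, opb (T n) e.

Definition op_cvg H K (T : nat -> L(H, K)) (S : L(H, K)) : Prop :=
  op_to0 (fun n => T n - S).

(** The bound is only eventual, as convergence provides it; [op_bdd_sup] recovers all indices. *)
Definition op_bdd H K (T : nat -> L(H, K)) : Prop :=
  exists2 c, 0 <= c & \forall n \near \oo, opb (T n) c.

Lemma op_to0P H K (T : nat -> L(H, K)) :
  (opnorm (T n) @[n --> \oo] --> 0%E) <-> op_to0 T.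
Proof.
split=> [/fine_cvgP[fT T0] e e0|T0].
  have /cvgrPdist_le/(_ e e0) := T0; apply: filterS2 fT => n fT.
  rewrite sub0r normrN /= => Te; apply/opnormP; first exact: ltW.
  by rewrite -(fineK fT) lee_fin (le_trans (ler_norm _)).
have fT e : 0 < e -> \forall n \near \oo, (opnorm (T n) <= e%:E)%E.
  by move=> e0; apply: filterS (T0 e e0) => n /opnormP; apply; exact: ltW.
have fin (e : R) n : (opnorm (T n) <= e%:E)%E -> opnorm (T n) \is a fin_num.
  move=> Te; rewrite ge0_fin_numE ?opnorm_ge0//.
  by rewrite (le_lt_trans Te) ?ltry.
apply/fine_cvgP; split.
  by apply: filterS (fT 1 ltr01) => n; exact: fin.
apply/cvgrPdist_le => e e0; apply: filterS (fT e e0) => n Te /=.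
rewrite sub0r normrN ger0_norm ?fine_ge0 ?opnorm_ge0//.
by rewrite -lee_fin fineK// (fin e).
Qed.

Lemma sup_opnormP H K (T : nat -> L(H, K)) :
  (ereal_sup (range (fun n => opnorm (T n))) < +oo)%E <->
  exists2 c, 0 <= c & forall n, opb (T n) c.
Proof.
set s := ereal_sup _.
have Ts n : (opnorm (T n) <= s)%E by apply: ereal_sup_ubound; exists n.
split=> [soo|[c c0 Tc]].
  have s0 : (0 <= s)%E by apply: le_trans (Ts 0%N); exact: opnorm_ge0.
  have sE : s = (fine s)%:E by rewrite fineK// ge0_fin_numE.
  exists (fine s); first exact: fine_ge0.
  by move=> n; apply/opnormP; rewrite ?fine_ge0// -sE.
apply: (@le_lt_trans _ _ c%:E); last exact: ltry.
by apply: ge_ereal_sup => _ [n _ <-]; exact/opnormP.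
Qed.

(** The finitely many initial terms are bounded one by one by [adjop_bounded]. *)
Lemma op_bdd_sup H K (T : nat -> L(H, K)) :
  op_bdd T -> exists2 c, 0 <= c & forall n, opb (T n) c.
Proof.
move=> [c c0 [m _ Tc]].
suff [d d0 Td] : exists2 d, 0 <= d & forall n, (n < m)%N -> opb (T n) d.
  exists (Num.max c d) => [|n]; first by rewrite le_max c0.
  have [mn|nm] := leqP m n; first by apply: opbW (Tc n mn); rewrite le_max lexx.
  by apply: opbW (Td n nm); rewrite le_max lexx orbT.
elim: m {Tc} => [|m [d d0 IH]]; first by exists 0.
have [e e0 Te] := adjop_bounded (T m).
exists (Num.max d e) => [|n]; first by rewrite le_max d0.
rewrite ltnS leq_eqVlt => /predU1P[->|nm].
  by apply: opbW Te; rewrite le_max lexx orbT.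
by apply: opbW (IH n nm); rewrite le_max lexx.
Qed.

Lemma sup_op_bdd H K (T : nat -> L(H, K)) :
  (exists2 c, 0 <= c & forall n, opb (T n) c) -> op_bdd T.
Proof. by move=> [c c0 Tc]; exists c => //; exact: nearW. Qed.

Lemma op_bdd_cst H K (T : L(H, K)) : op_bdd (fun=> T).
Proof.
by have [c c0 Tc] := adjop_bounded T; exists c => //; exact: nearW.
Qed.

Lemma op_bddD H K (S T : nat -> L(H, K)) :
  op_bdd S -> op_bdd T -> op_bdd (fun n => S n + T n).
Proof.
move=> [a a0 Sa] [b b0 Tb]; exists (a + b); first exact: addr_ge0.
by apply: filterS2 Sa Tb => n; exact: opbD.
Qed.

Lemma op_bddN H K (T : nat -> L(H, K)) :
  op_bdd T -> op_bdd (fun n => - T n).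
Proof. by move=> [a a0 Ta]; exists a => //; apply: filterS Ta => n /opbN. Qed.

Lemma op_bdd_comp H K G (S : nat -> L(K, G)) (T : nat -> L(H, K)) :
  op_bdd S -> op_bdd T -> op_bdd (fun n => S n ∘ T n).
Proof.
move=> [a a0 Sa] [b b0 Tb]; exists (a * b); first exact: mulr_ge0.
by apply: filterS2 Sa Tb => n; exact: opb_comp.
Qed.

Lemma op_bdd_adj H K (T : nat -> L(H, K)) :
  op_bdd T -> op_bdd (fun n => adj (T n)).
Proof.
move=> [c c0 Tc]; exists (4 * c); first by rewrite mulr_ge0.
by apply: filterS Tc => n; exact: opb_adj.
Qed.

Lemma eq_op_to0 H K (S T : nat -> L(H, K)) : S =1 T -> op_to0 T -> op_to0 S.
Proof. by move=> /funext ->. Qed.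

Lemma op_to0D H K (S T : nat -> L(H, K)) :
  op_to0 S -> op_to0 T -> op_to0 (fun n => S n + T n).
Proof.
move=> S0 T0 e e0; have e2 : 0 < e / 2 by rewrite divr_gt0.
apply: filterS2 (S0 _ e2) (T0 _ e2) => n Se Te.
by rewrite [e]splitr; exact: opbD.
Qed.

Lemma op_to0N H K (T : nat -> L(H, K)) : op_to0 T -> op_to0 (fun n => - T n).
Proof. by move=> T0 e e0; apply: filterS (T0 e e0) => n /opbN. Qed.

Lemma op_to0B H K (S T : nat -> L(H, K)) :
  op_to0 S -> op_to0 T -> op_to0 (fun n => S n - T n).
Proof. by move=> S0 T0; apply: op_to0D => //; exact: op_to0N. Qed.

Lemma op_to0_compl H K G (S : nat -> L(K, G)) (T : nat -> L(H, K)) :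
  op_bdd S -> op_to0 T -> op_to0 (fun n => S n ∘ T n).
Proof.
move=> [c c0 Sc] T0 e e0; have c1 : 0 < c + 1 by rewrite ltr_wpDl.
have := T0 (e / (c + 1)) (divr_gt0 e0 c1); apply: filterS2 Sc => n Sc Te.
have -> : e = (c + 1) * (e / (c + 1)) by rewrite mulrC divfK// gt_eqF.
apply: opb_comp => //; first exact: ltW.
by apply: opbW Sc; rewrite lerDl.
Qed.

Lemma op_to0_compr H K G (S : nat -> L(K, G)) (T : nat -> L(H, K)) :
  op_to0 S -> op_bdd T -> op_to0 (fun n => S n ∘ T n).
Proof.
move=> S0 [c c0 Tc] e e0; have c1 : 0 < c + 1 by rewrite ltr_wpDl.
have := S0 (e / (c + 1)) (divr_gt0 e0 c1); apply: filterS2 Tc => n Tc Se.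
have -> : e = e / (c + 1) * (c + 1) by rewrite divfK// gt_eqF.
apply: opb_comp => //; first by rewrite ltW// divr_gt0.
by apply: opbW Tc; rewrite lerDl.
Qed.

Lemma op_cvg_cst H K (T : L(H, K)) : op_cvg (fun=> T) T.
Proof.
move=> e e0; apply: nearW => n x; rewrite subrr nrm0.
by rewrite mulr_ge0 ?nrm_ge0// ltW.
Qed.

Lemma op_cvg_bdd H K (T : nat -> L(H, K)) (S : L(H, K)) :
  op_cvg T S -> op_bdd T.
Proof.
move=> TS; have [c c0 Sc] := adjop_bounded S.
exists (1 + c); first by rewrite addr_ge0.
apply: filterS (TS 1 ltr01) => n TS1; rewrite -(subrK S (T n)).
exact: opbD.
Qed.

Lemma op_cvgD H K (T T' : nat -> L(H, K)) (S S' : L(H, K)) :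
  op_cvg T S -> op_cvg T' S' -> op_cvg (fun n => T n + T' n) (S + S').
Proof.
move=> TS TS'; apply: eq_op_to0 (op_to0D TS TS') => n.
by rewrite opprD addrACA.
Qed.

Lemma op_cvgN H K (T : nat -> L(H, K)) (S : L(H, K)) :
  op_cvg T S -> op_cvg (fun n => - T n) (- S).
Proof.
by move=> TS; apply: eq_op_to0 (op_to0N TS) => n; rewrite opprD.
Qed.

Lemma op_cvgB H K (T T' : nat -> L(H, K)) (S S' : L(H, K)) :
  op_cvg T S -> op_cvg T' S' -> op_cvg (fun n => T n - T' n) (S - S').
Proof. by move=> TS TS'; apply: op_cvgD => //; exact: op_cvgN. Qed.

Lemma op_cvg_comp H K G (T : nat -> L(K, G)) (T' : nat -> L(H, K)) S S' :
  op_cvg T S -> op_cvg T' S' -> op_cvg (fun n => T n ∘ T' n) (S ∘ S').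
Proof.
move=> TS TS'.
apply: eq_op_to0 (op_to0D (op_to0_compl (op_cvg_bdd TS) TS')
  (op_to0_compr TS (op_bdd_cst S'))) => n.
by rewrite opcompBr opcompBl addrA subrK.
Qed.

Lemma op_cvg_adj H K (T : nat -> L(H, K)) (S : L(H, K)) :
  op_cvg T S -> op_cvg (fun n => adj (T n)) (adj S).
Proof.
move=> TS e e0; have e4 : 0 < 4^-1 * e by rewrite mulr_gt0.
apply: filterS (TS _ e4) => n /(opb_adj (ltW e4)).
by rewrite adjB mulVKf.
Qed.

(** Once [E n] has bound [1 / 2], [nrm (V n x) <= c * nrm x + nrm (V n x) / 2], and the last term is
    absorbed on the left. *)
Lemma op_bdd_absorb H K (V W : nat -> L(H, K)) (E : nat -> L(K, K)) :
  op_bdd W -> op_to0 E -> (forall n, V n = W n - E n ∘ V n) -> op_bdd V.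
Proof.
move=> [c c0 Wc] E0 VE; have e2 : 0 < 2^-1 :> R by rewrite invr_gt0.
exists (2 * c); first by rewrite mulr_ge0.
apply: filterS2 Wc (E0 _ e2) => n Wc Ec x.
have := nrmB (W n x) (E n (V n x)).
rewrite -[W n x - _]/((W n - E n ∘ V n) x) -VE.
have := Wc x; have := Ec (V n x); lra.
Qed.

End operator_norm.

(** * Limits of ordinary and weighted Moore-Penrose inverses *)

Section moore_penrose_limits.
Variables (R : realType) (A : cstarAlgType R).
Implicit Types H K : hilbertModType A.

Lemma is_mpinv_adj H K (T : L(H, K)) (Y : L(K, H)) :
  is_mpinv T Y -> is_mpinv (adj T) (adj Y).
Proof.
move=> [TYT YTY TY YT]; split; rewrite -!adj_comp ?opcompA ?TYT ?YTY//.
  by rewrite YT.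
by rewrite TY.
Qed.

Lemma is_mpinv_opbl H K (T : L(H, K)) (Y : L(K, H)) :
  is_mpinv T Y -> opb (Y ∘ T) 1.
Proof.
move=> [TYT YTY TY YT]; apply: projection_opb => //.
by rewrite -opcompA [T ∘ _]opcompA TYT.
Qed.

Lemma is_mpinv_opbr H K (T : L(H, K)) (Y : L(K, H)) :
  is_mpinv T Y -> opb (T ∘ Y) 1.
Proof.
move=> [TYT YTY TY YT]; apply: projection_opb => //.
by rewrite opcompA TYT.
Qed.

Section sequence.
Variables (H K : hilbertModType A).
Variables (T : L(H, K)) (Tn : nat -> L(H, K)).
Variables (Y : L(K, H)) (Yn : nat -> L(K, H)).
Hypothesis TY : is_mpinv T Y.
Hypothesis TnYn : forall n, is_mpinv (Tn n) (Yn n).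
Hypothesis Tcvg : op_cvg Tn T.

Lemma mpinv_corange_bdd : op_bdd (fun n => Yn n ∘ Tn n).
Proof. by exists 1 => //; apply: nearW => n; exact: is_mpinv_opbl. Qed.

Lemma mpinv_range_bdd : op_bdd (fun n => Tn n ∘ Yn n).
Proof. by exists 1 => //; apply: nearW => n; exact: is_mpinv_opbr. Qed.

Lemma mpinv_bdd_corange :
  op_bdd Yn -> op_cvg (fun n => Yn n ∘ Tn n) (Y ∘ T).
Proof.
move=> Ybdd; have [TYT _ _ YT] := TY.
have a0 : op_to0 (fun n => Yn n ∘ (Tn n - T) ∘ (opid H - Y ∘ T)).
  by apply: op_to0_compr; [exact: op_to0_compl|exact: op_bdd_cst].
have b0 : op_to0 (fun n =>
    (opid H - Yn n ∘ Tn n) ∘ (adj (Tn n) - adj T) ∘ adj Y).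
  apply: op_to0_compr; last exact: op_bdd_cst.
  apply: op_to0_compl; last exact: op_cvg_adj.
  by apply: op_bddD; [exact: op_bdd_cst|exact: op_bddN mpinv_corange_bdd].
apply: eq_op_to0 (op_to0D a0 b0) => n; have [TYTn _ _ YTn] := TnYn n.
have -> : Yn n ∘ (Tn n - T) ∘ (opid H - Y ∘ T)
    = Yn n ∘ Tn n - Yn n ∘ Tn n ∘ (Y ∘ T).
  rewrite -[LHS]opcompA [(Tn n - T) ∘ _]opcompBl ![_ ∘ (opid H - _)]opcompBr.
  by rewrite !opcompo1 [T ∘ (Y ∘ T)]opcompA TYT subrr subr0 opcompBr opcompA.
have -> : (opid H - Yn n ∘ Tn n) ∘ (adj (Tn n) - adj T) ∘ adj Y
    = - (Y ∘ T - Yn n ∘ Tn n ∘ (Y ∘ T)).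
  have E : (opid H - Yn n ∘ Tn n) ∘ adj (Tn n) = 0.
    rewrite opcompBl opcomp1o -[in X in _ - X]YTn -adj_comp.
    by rewrite opcompA TYTn subrr.
  rewrite opcompBr E sub0r opcompNl -opcompA -adj_comp YT.
  by rewrite opcompBl opcomp1o.
by rewrite opprB addrA subrK.
Qed.

(** Absorption with [E_n = Y T_n - Y_n T_n], which tends to [Y T - Y T = 0]. *)
Lemma mpinv_corange_bdd_mpinv :
  op_cvg (fun n => Yn n ∘ Tn n) (Y ∘ T) -> op_bdd Yn.
Proof.
move=> qcvg.
apply: (@op_bdd_absorb _ _ _ _ _ (fun n => Y ∘ (Tn n ∘ Yn n))
  (fun n => Y ∘ Tn n - Yn n ∘ Tn n)).
- by apply: op_bdd_comp; [exact: op_bdd_cst|exact: mpinv_range_bdd].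
- have := op_to0B (op_cvg_comp (op_cvg_cst Y) Tcvg) qcvg.
  by apply: eq_op_to0 => n; rewrite opprB addrA subrK.
- move=> n; have [_ YTYn _ _] := TnYn n.
  by rewrite opcompBl YTYn opcompA opprB addrC subrK.
Qed.

(** [Y_n - Y = Y_n (T_n Y_n - T Y) - Y_n (T_n - T) Y + (Y_n T_n - Y T) Y]. *)
Lemma mpinv_cvg : op_bdd Yn ->
  op_cvg (fun n => Yn n ∘ Tn n) (Y ∘ T) ->
  op_cvg (fun n => Tn n ∘ Yn n) (T ∘ Y) -> op_cvg Yn Y.
Proof.
move=> Ybdd qcvg pcvg; have [_ YTY _ _] := TY.
have a0 := op_to0_compl Ybdd pcvg.
have b0 := op_to0_compr (op_to0_compl Ybdd Tcvg) (op_bdd_cst Y).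
have c0 := op_to0_compr qcvg (op_bdd_cst Y).
apply: eq_op_to0 (op_to0D (op_to0B a0 b0) c0) => n.
have [_ YTYn _ _] := TnYn n.
rewrite !opcompBr !opcompBl YTY !opcompA YTYn opprB.
by rewrite !subrKA.
Qed.

End sequence.

Section adjoint_sequence.
Variables (H K : hilbertModType A).
Variables (T : L(H, K)) (Tn : nat -> L(H, K)).
Variables (Y : L(K, H)) (Yn : nat -> L(K, H)).
Hypothesis TY : is_mpinv T Y.
Hypothesis TnYn : forall n, is_mpinv (Tn n) (Yn n).
Hypothesis Tcvg : op_cvg Tn T.

Let TYa := is_mpinv_adj TY.
Let TnYna n := is_mpinv_adj (TnYn n).
Let rangeE n : adj (Yn n) ∘ adj (Tn n) = Tn n ∘ Yn n.
Proof. by rewrite -adj_comp; have [] := TnYn n. Qed.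
Let rangeE0 : adj Y ∘ adj T = T ∘ Y.
Proof. by rewrite -adj_comp; have [] := TY. Qed.

(** [T_n Y_n = Y_n^* T_n^*] is the corange projection of [T_n^*]. *)
Lemma mpinv_bdd_range :
  op_bdd Yn -> op_cvg (fun n => Tn n ∘ Yn n) (T ∘ Y).
Proof.
move=> /op_bdd_adj /(mpinv_bdd_corange TYa TnYna (op_cvg_adj Tcvg)).
by apply: eq_op_to0 => n; rewrite rangeE rangeE0.
Qed.

Lemma mpinv_range_bdd_mpinv :
  op_cvg (fun n => Tn n ∘ Yn n) (T ∘ Y) -> op_bdd Yn.
Proof.
move=> pcvg.
have /op_bdd_adj : op_bdd (fun n => adj (Yn n)).
  apply: (mpinv_corange_bdd_mpinv (T := adj T) (Y := adj Y) TnYna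
    (op_cvg_adj Tcvg)).
  by apply: eq_op_to0 pcvg => n; rewrite rangeE rangeE0.
by under eq_fun do rewrite adjK.
Qed.

End adjoint_sequence.

(** [W_n = B p_n M_n] tends to [P], and [P_n = W_n - E_n P_n] with [E_n = W_n p_n - p_n] tending to
    [P p - p = 0]; so [P_n] is bounded by absorption, then has the limit of [W_n]. *)
Lemma weighted_projection_cvg K (M : L(K, K)) (Mn : nat -> L(K, K))
    (p P : L(K, K)) (pn Pn : nat -> L(K, K)) :
  weight M -> (forall n, weight (Mn n)) -> op_cvg Mn M -> op_cvg pn p ->
  adj p = p -> (forall n, adj (pn n) = pn n) ->
  p ∘ P = P -> P ∘ p = p -> adj (M ∘ P) = M ∘ P ->
  (forall n, pn n ∘ Pn n = Pn n) -> (forall n, Pn n ∘ pn n = pn n) ->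
  (forall n, adj (Mn n ∘ Pn n) = Mn n ∘ Pn n) ->
  op_cvg Pn P.
Proof.
move=> [sM [M' [_ M'M]]] wMn Mcvg pcvg sp spn pP Pp sMP pPn Ppn sMPn.
pose B := M' ∘ adj P.
(* [B p M = M^-1 (p P)^* M = M^-1 P^* M = P], as [M P] is selfadjoint. *)
have BpM : B ∘ p ∘ M = P.
  rewrite -[B ∘ p]opcompA -{1}sp -adj_comp pP -opcompA.
  by rewrite -{1}sM -adj_comp sMP opcompA M'M opcomp1o.
(* [M_n P_n] equals its adjoint [P_n^* M_n], and [p_n P_n^* = (P_n p_n)^* = p_n]. *)
have pMP n : pn n ∘ Mn n ∘ Pn n = pn n ∘ Mn n.
  have [sMn _] := wMn n.
  rewrite -opcompA -sMPn adj_comp sMn opcompA -{1}spn.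
  by rewrite -adj_comp Ppn spn.
pose E n := B ∘ pn n ∘ Mn n ∘ pn n - pn n.
have Wcvg : op_cvg (fun n => B ∘ pn n ∘ Mn n) P.
  rewrite -BpM; apply: op_cvg_comp => //; apply: op_cvg_comp => //.
  exact: op_cvg_cst.
have E0 : op_to0 E.
  have := op_cvgB (op_cvg_comp Wcvg pcvg) pcvg.
  by apply: eq_op_to0 => n; rewrite Pp subrr subr0.
have PnE n : Pn n = B ∘ pn n ∘ Mn n - E n ∘ Pn n.
  rewrite opcompBl -[_ ∘ pn n ∘ Pn n]opcompA pPn.
  rewrite -!(opcompA B) pMP opprB addrC subrK.
  by [].
have Pbdd := op_bdd_absorb (op_cvg_bdd Wcvg) E0 PnE.
apply: eq_op_to0 (op_to0B Wcvg (op_to0_compr E0 Pbdd)) => n.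
by rewrite {1}PnE addrAC.
Qed.

Lemma wmpinv_cvg H K (M : L(K, K)) (Mn : nat -> L(K, K))
    (N : L(H, H)) (Nn : nat -> L(H, H)) (T : L(H, K)) (Tn : nat -> L(H, K))
    (X Y : L(K, H)) (Xn Yn : nat -> L(K, H)) :
  weight M -> (forall n, weight (Mn n)) -> op_cvg Mn M ->
  weight N -> (forall n, weight (Nn n)) -> op_cvg Nn N ->
  is_wmpinv M N T X -> (forall n, is_wmpinv (Mn n) (Nn n) (Tn n) (Xn n)) ->
  is_mpinv T Y -> (forall n, is_mpinv (Tn n) (Yn n)) ->
  op_cvg Tn T -> op_cvg Yn Y -> op_cvg Xn X.
Proof.
move=> wM wMn Mcvg wN wNn Ncvg TX TnXn TY TnYn Tcvg Ycvg.
have range (M0 : L(K, K)) N0 (S : L(H, K)) X0 Y0 :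
    is_wmpinv M0 N0 S X0 -> is_mpinv S Y0 ->
    [/\ (S ∘ Y0) ∘ (S ∘ X0) = S ∘ X0, (S ∘ X0) ∘ (S ∘ Y0) = S ∘ Y0,
        adj (S ∘ Y0) = S ∘ Y0 & adj (M0 ∘ (S ∘ X0)) = M0 ∘ (S ∘ X0)].
  by move=> [SXS _ MSX _] [SYS _ SY _]; rewrite !opcompA SXS SYS.
(* [X0 ∘ S] and [Y0 ∘ S] share their kernel, not their range; the complements [Q] and [q] both have
   the kernel of [S] as range, so the projection lemma applies to them with weight [N0]. *)
have corange (M0 : L(K, K)) N0 (S : L(H, K)) X0 Y0 (q := opid H - Y0 ∘ S)
    (Q := opid H - X0 ∘ S) :
    weight N0 -> is_wmpinv M0 N0 S X0 -> is_mpinv S Y0 ->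
    [/\ q ∘ Q = Q, Q ∘ q = q, adj q = q & adj (N0 ∘ Q) = N0 ∘ Q].
  move=> [sN _] [SXS _ _ NXS] [SYS _ _ YS].
  have XY : (X0 ∘ S) ∘ (Y0 ∘ S) = X0 ∘ S by rewrite opcompA -!(opcompA X0) SYS.
  have YX : (Y0 ∘ S) ∘ (X0 ∘ S) = Y0 ∘ S by rewrite opcompA -!(opcompA Y0) SXS.
  split.
  - by rewrite opcompBl opcomp1o /Q opcompBr opcompo1 YX subrr subr0.
  - by rewrite opcompBl opcomp1o /q opcompBr opcompo1 XY subrr subr0.
  - by rewrite adjB adj_opid YS.
  - by rewrite opcompBr opcompo1 opcompA adjB NXS sN.
have factor (M0 : L(K, K)) N0 (S : L(H, K)) X0 Y0 :
    is_wmpinv M0 N0 S X0 -> is_mpinv S Y0 ->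
    X0 ∘ S ∘ Y0 ∘ (S ∘ X0) = X0.
  move=> [_ XSX _ _] [SYS _ _ _].
  by rewrite opcompA -(opcompA X0 S) -(opcompA X0 _ S) SYS.
have Pcvg : op_cvg (fun n => Tn n ∘ Xn n) (T ∘ X).
  have [pP Pp sp sP] := range _ _ _ _ _ TX TY.
  apply: (weighted_projection_cvg wM wMn Mcvg (op_cvg_comp Tcvg Ycvg)) => // n;
    by have [] := range _ _ _ _ _ (TnXn n) (TnYn n).
have Qcvg : op_cvg (fun n => opid H - Xn n ∘ Tn n) (opid H - X ∘ T).
  have [pP Pp sp sP] := corange _ _ _ _ _ wN TX TY.
  have qcvg := op_cvgB (op_cvg_cst (opid H)) (op_cvg_comp Ycvg Tcvg).
  apply: (weighted_projection_cvg wN wNn Ncvg qcvg) => // n;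
    by have [] := corange _ _ _ _ _ (wNn n) (TnXn n) (TnYn n).
have {}Qcvg : op_cvg (fun n => Xn n ∘ Tn n) (X ∘ T).
  apply: eq_op_to0 (op_to0N Qcvg) => n.
  by rewrite [RHS]opprB opprB [RHS]addrC subrKA.
apply: eq_op_to0 (op_cvg_comp (op_cvg_comp Qcvg Ycvg) Pcvg) => n.
by rewrite (factor _ _ _ _ _ TX TY) (factor _ _ _ _ _ (TnXn n) (TnYn n)).
Qed.

End moore_penrose_limits.

(** * The cycle of implications from (i) to (vi) and back *)

Theorem theorem5p2 (R : realType) (AA : cstarAlgType R)
    (H K : hilbertModType AA)
    (A : L(H, K)) (An : nat -> L(H, K))
    (M : L(K, K)) (Mn : nat -> L(K, K))
    (N : L(H, H)) (Nn : nat -> L(H, H))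
    (A_neq0 : A != 0) (An_neq0 : forall n, An n != 0)
    (M_weight : weight M) (Mn_weight : forall n, weight (Mn n))
    (N_weight : weight N) (Nn_weight : forall n, weight (Nn n))
    (cvg_An : opnorm (An n - A) @[n --> \oo] --> 0%E)
    (cvg_Mn : opnorm (Mn n - M) @[n --> \oo] --> 0%E)
    (cvg_Nn : opnorm (Nn n - N) @[n --> \oo] --> 0%E)
    (A_wmp : wmpinv_exists M N A)
    (An_wmp : forall n, wmpinv_exists (Mn n) (Nn n) (An n)) :
  [<-> (* (i) *)
       opnorm (wmpinv (Mn n) (Nn n) (An n) - wmpinv M N A) @[n --> \oo]
         --> 0%E;
       (* (ii) *)
       (ereal_sup (range (fun n => opnorm (wmpinv (Mn n) (Nn n) (An n))))
         < +oo)%E;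
       (* (iii) *)
       (ereal_sup (range (fun n => opnorm (mpinv (An n)))) < +oo)%E;
       (* (iv) *)
       opnorm (mpinv (An n) ∘ An n - mpinv A ∘ A) @[n --> \oo] --> 0%E;
       (* (v) *)
       opnorm (An n ∘ mpinv (An n) - A ∘ mpinv A) @[n --> \oo] --> 0%E;
       (* (vi) *)
       opnorm (mpinv (An n) - mpinv A) @[n --> \oo] --> 0%E].
Proof.
have A_X := wmpinvP A_wmp; have An_Xn n := wmpinvP (An_wmp n).
have [A_Y _] : is_mpinv A (mpinv A) /\ forall c, 0 <= c ->
    opb (wmpinv M N A) c -> opb (mpinv A) c.
  by apply: mpinv_exists; case: A_X.
have An_Y n : is_mpinv (An n) (mpinv (An n)) /\ forall c, 0 <= c ->
    opb (wmpinv (Mn n) (Nn n) (An n)) c -> opb (mpinv (An n)) c.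
  by apply: mpinv_exists; case: (An_Xn n).
have An_Yn n : is_mpinv (An n) (mpinv (An n)) by case: (An_Y n).
move/op_to0P in cvg_An; move/op_to0P in cvg_Mn; move/op_to0P in cvg_Nn.
tfae.
- move=> /op_to0P Xcvg; apply/sup_opnormP/op_bdd_sup.
  exact: op_cvg_bdd Xcvg.
- move=> /sup_opnormP[c c0 Xc]; apply/sup_opnormP; exists c => // n.
  by have [_] := An_Y n; exact.
- move=> /sup_opnormP/sup_op_bdd Ybdd; apply/op_to0P.
  exact: (mpinv_bdd_corange A_Y An_Yn cvg_An Ybdd).
(* Convergence of one family of projections first bounds the inverses; this bound yields the other
   family. *)
- move=> /op_to0P qcvg; apply/op_to0P.
  have Ybdd := mpinv_corange_bdd_mpinv An_Yn cvg_An qcvg.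
  exact: (mpinv_bdd_range A_Y An_Yn cvg_An Ybdd).
- move=> /op_to0P pcvg; apply/op_to0P.
  have Ybdd := mpinv_range_bdd_mpinv A_Y An_Yn cvg_An pcvg.
  have qcvg := mpinv_bdd_corange A_Y An_Yn cvg_An Ybdd.
  exact: (mpinv_cvg A_Y An_Yn cvg_An Ybdd qcvg pcvg).
- move=> /op_to0P Ycvg; apply/op_to0P.
  exact: (wmpinv_cvg M_weight Mn_weight cvg_Mn N_weight Nn_weight cvg_Nn
    A_X An_Xn A_Y An_Yn).
Qed.
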